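(* Let $\mathbb M$ be an o-minimal expansion of the ordered set of real numbers. Suppose that $\mathbb M$ has definable Skolem functions. Let $X$ be a Hausdorff definable space. Then the following are equivalent: (1) $X$ is definably compact. (2) $X$ is compact.
   Context: ''Definable'' means definable in $\mathbb M=(M,<,\ldots)$ (here $M=\mathbb R$), possibly with parameters. $\mathbb M$ has definable Skolem functions if for every uniformly definable family $\{F_t\}_{t\in T}$ of nonempty definable sets there is a definable map $f:T\to\bigcup_t F_t$ with $f(t)\in F_t$ for all $t\in T$. A definable space is a set $X=\bigcup_{i\le k}X_i$ with injections (definable charts) $\theta_i:X_i\to M^{n_i}$ ($i\le k$, $k$ finite) such that each $\theta_i(X_i)$ is a definable subset of $M^{n_i}$ (with the induced topology), each $\theta_i(X_i\cap X_j)$ is an open definable subset of $\theta_i(X_i)$, and each transition map $\theta_j\circ\theta_i^{-1}:\theta_i(X_i\cap X_j)\to\theta_j(X_i\cap X_j)$ is a definable homeomorphism. $X$ carries the topology in which each $X_i$ is open and each $\theta_i$ is a homeomorphism. A map $f:X\to Y$ between definable spaces with charts $(X_i,\theta_i)$, $(Y_j,\delta_j)$ is definable if each $\delta_j\circ f\circ\theta_i^{-1}$ (on its natural domain) is a definable map between definable sets. A definable curve in $X$ is a continuous definable map $\alpha:(a,b)\to X$, with $a<b$ in $M\cup\{-\infty,+\infty\}$; it is completable in $X$ if both limits $\lim_{t\to a^+}\alpha(t)$ and $\lim_{t\to b^-}\alpha(t)$ exist in $X$. $X$ is definably compact if every definable curve in $X$ is completable in $X$. *)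

(* Defs.v *)
From HB Require Import structures.
From mathcomp Require Import all_boot all_order all_algebra.
From mathcomp Require Import all_classical all_reals all_analysis.
Import Order.TTheory GRing.Theory Num.Theory.
Import numFieldNormedType.Exports.

Set Implicit Arguments.
Unset Strict Implicit.
Unset Printing Implicit Defensive.

Local Open Scope classical_set_scope.
Local Open Scope ring_scope.

(* First-order expansions [(R, <, ...)]: the records below carry the extra
   symbols only; equality and [<] are built into the formulas. *)
Record expansion (R : realType) := Expansion {
  rel_sym : Type;
  rel_arity : rel_sym -> nat;
  rel_val : forall r : rel_sym, set 'rV[R]_(rel_arity r);
  fun_sym : Type;
  fun_arity : fun_sym -> nat;
  fun_val : forall f : fun_sym, 'rV[R]_(fun_arity f) -> R }.

Section Definability.
Variables (R : realType) (M : expansion R).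

Inductive term (n : nat) : Type :=
| Var (i : 'I_n)
| App (f : fun_sym M) (ts : 'I_(fun_arity f) -> term n).

(* [formula n]: formulas with free variables among [0, ..., n - 1]; [Ex] binds
   the last variable of its body. *)
Inductive formula : nat -> Type :=
| Eq n (s t : term n) : formula n
| Lt n (s t : term n) : formula n
| Rel n (r : rel_sym M) (ts : 'I_(rel_arity r) -> term n) : formula n
| Not n (p : formula n) : formula n
| And n (p q : formula n) : formula n
| Ex n (p : formula (n + 1)) : formula n.

Fixpoint eval n (v : 'rV[R]_n) (t : term n) : R :=
  match t with
  | Var i => v ord0 i
  | App f ts => fun_val (\row_i eval v (ts i))
  end.

Fixpoint sat n (p : formula n) : 'rV[R]_n -> Prop :=
  match p with
  | Eq n s t => fun v => eval v s = eval v t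
  | Lt n s t => fun v => eval v s < eval v t
  | Rel n r ts => fun v => rel_val (\row_i eval v (ts i))
  | Not n p => fun v => ~ sat p v
  | And n p q => fun v => sat p v /\ sat q v
  | Ex n p => fun v => exists y : R, sat p (row_mx v (const_mx y))
  end.

(* The row [c] holds the parameters. *)
Definition definable n (A : set 'rV[R]_n) : Prop :=
  exists (k : nat) (c : 'rV[R]_k) (p : formula (n + k)),
    A = [set x | sat p (row_mx x c)].

(* Functions are total; only their values on [A] matter. *)
Definition definable_map m n (A : set 'rV[R]_m) (f : 'rV[R]_m -> 'rV[R]_n) :=
  definable [set row_mx x (f x) | x in A].

Definition o_minimal : Prop :=
  forall A : set 'rV[R]_1, definable A ->
    exists (pts : seq R) (itvs : seq (\bar R * \bar R)),
      A = [set x : 'rV[R]_1 | x ord0 ord0 \in pts \/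
             exists2 ab, ab \in itvs & (ab.1 < (x ord0 ord0)%:E < ab.2)%E].

Definition definable_skolem : Prop :=
  forall (m n : nat) (T : set 'rV[R]_m) (F : 'rV[R]_m -> set 'rV[R]_n),
    definable T ->
    definable [set z | exists t x, [/\ T t, F t x & z = row_mx t x]] ->
    (forall t, T t -> F t !=set0) ->
    exists2 f, definable_map T f & forall t, T t -> F t (f t).

Definition open_in (T : topologicalType) (D A : set T) : Prop :=
  exists2 V, open V & A = D `&` V.

Definition definable_homeo m n (A : set 'rV[R]_m) (B : set 'rV[R]_n)
    (g : 'rV[R]_m -> 'rV[R]_n) : Prop :=
  [/\ set_bij A B g, definable_map A g, {within A, continuous g} &
      exists2 h, (forall x, A x -> h (g x) = x) & {within B, continuous h}].

(* Each [chart i] is a total function, relevant only on [chart_dom i]. The last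
   field says that the transition map, i.e. the map [g] determined on
   [chart i @` (chart_dom i `&` chart_dom j)] by [g \o chart i = chart j], is a
   definable homeomorphism. *)
Record definable_space := DefinableSpace {
  carrier :> Type;
  nb_charts : nat;
  chart_dim : 'I_nb_charts -> nat;
  chart_dom : 'I_nb_charts -> set carrier;
  chart : forall i, carrier -> 'rV[R]_(chart_dim i);
  chart_cover : forall x, exists i, chart_dom i x;
  chart_inj : forall i x y, chart_dom i x -> chart_dom i y ->
    chart i x = chart i y -> x = y;
  chart_definable : forall i, definable (chart i @` chart_dom i);
  overlap_definable : forall i j,
    definable (chart i @` (chart_dom i `&` chart_dom j));
  overlap_open : forall i j,
    open_in (chart i @` chart_dom i) (chart i @` (chart_dom i `&` chart_dom j));
  transition_homeo : forall i j, exists2 g,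
    (forall x, chart_dom i x -> chart_dom j x -> g (chart i x) = chart j x) &
    definable_homeo (chart i @` (chart_dom i `&` chart_dom j))
                    (chart j @` (chart_dom i `&` chart_dom j)) g }.

End Definability.

Section Topology.
Variables (R : realType) (M : expansion R) (X : definable_space M).

HB.instance Definition _ := gen_eqMixin (carrier X).
HB.instance Definition _ := gen_choiceMixin (carrier X).

(* By [chart_dom_open] and [chart_homeo] below, this is the topology in which
   the chart domains are open and the charts are homeomorphisms. *)
Definition space_open (U : set X) : Prop :=
  forall i, open_in (chart i @` chart_dom i) (chart i @` (U `&` chart_dom i)).

Lemma chart_imageI i (U V : set X) :
  chart i @` (U `&` V `&` chart_dom i) =
  chart i @` (U `&` chart_dom i) `&` chart i @` (V `&` chart_dom i).
Proof.
apply/seteqP; split=> [_ [x [[Ux Vx] dx] <-]|y].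
  by split; exists x.
move=> [[x [Ux dx] <-] [x' [Vx dx'] e]]; exists x => //.
by split=> //; split=> //; rewrite (chart_inj dx dx' (esym e)).
Qed.

Lemma space_openT : space_open setT.
Proof.
move=> i; exists setT; last by rewrite setTI setIT.
exact: openT.
Qed.

Lemma space_openI : setI_closed space_open.
Proof.
move=> U V oU oV i; have [A oA eA] := oU i; have [B oB eB] := oV i.
exists (A `&` B); first exact: openI.
by rewrite chart_imageI eA eB setIACA setIid.
Qed.

Lemma space_open_bigU (I : Type) (f : I -> set X) :
  (forall k, space_open (f k)) -> space_open (\bigcup_k f k).
Proof.
move=> of_ i; have /choice[V hV] : forall k, exists V, open V /\
    chart i @` (f k `&` chart_dom i) = chart i @` chart_dom i `&` V.
  by move=> k; have [V oV eV] := of_ k i; exists V.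
exists (\bigcup_k V k); first by apply: bigcup_open => k _; have [] := hV k.
by rewrite setI_bigcupl image_bigcup setI_bigcupr; apply: eq_bigcupr => k _;
  have [] := hV k.
Qed.

HB.instance Definition _ := isOpenTopological.Build (carrier X)
  space_openT space_openI space_open_bigU.

Lemma space_openE (U : set X) : open U = space_open U.
Proof. by []. Qed.

Lemma chart_dom_open (i : 'I_(nb_charts X)) : open (chart_dom i : set X).
Proof. by move=> j; rewrite setIC; exact: overlap_open. Qed.

Lemma chart_homeo (i : 'I_(nb_charts X)) (U : set X) : U `<=` chart_dom i ->
  open U <-> open_in (chart i @` chart_dom i) (chart i @` U).
Proof.
rewrite space_openE => Ui; split=> [/(_ i)|[V oV eV] j].
  by rewrite (setIidl Ui).
have [g gE [_ _ cg _]] := transition_homeo j i.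
have [W oW eW] := overlap_open j i.
have /open_subspaceP[V' oV' eV'] := (continuousP _).1 cg V oV.
exists (W `&` V'); first exact: openI.
rewrite setIA -eW [RHS]setIC eV' /from_subspace.
apply/seteqP; split=> [_ [x [Ux dx] <-]|y [+ [x [dj di] e]]].
  have di := Ui _ Ux; split; last by exists x.
  rewrite /preimage/= gE//; have : (chart i @` U) (chart i x) by exists x.
  by rewrite eV => -[].
rewrite -{}e /preimage/= gE// => Vg.
have : (chart i @` chart_dom i `&` V) (chart i x).
  by split=> //; exists x.
rewrite -eV => -[z Uz ezx]; exists x => //; split=> //.
by rewrite -(chart_inj (Ui _ Uz) di ezx).
Qed.

(* [alpha] is only relevant on the interval, which is a definable space through
   the chart sending [t] to the row [const_mx t]. *)
Definition definable_curve (a b : \bar R) (alpha : R -> X) : Prop :=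
  [/\ (a < b)%E,
      {within [set t : R | (a < t%:E < b)%E], continuous alpha} &
      forall j : 'I_(nb_charts X), definable M
        [set row_mx (const_mx t : 'rV_1) (chart j (alpha t)) | t in
           [set t | (a < t%:E < b)%E /\ chart_dom j (alpha t)]]].

(* For [a < b], the right filter at [a] and the left filter at [b]; the
   remaining branches are irrelevant. *)
Definition right_of (a : \bar R) : set_system R :=
  match a with
  | r%:E => r^'+
  | -oo => ninfty_nbhs R
  | +oo => pinfty_nbhs R
  end%E.

Definition left_of (b : \bar R) : set_system R :=
  match b with
  | r%:E => r^'-
  | -oo => ninfty_nbhs R
  | +oo => pinfty_nbhs R
  end%E.

Definition completable (a b : \bar R) (alpha : R -> X) : Prop :=
  (exists x : X, alpha @ right_of a --> x) /\
  (exists y : X, alpha @ left_of b --> y).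

Definition definably_compact : Prop :=
  forall (a b : \bar R) (alpha : R -> X),
    definable_curve a b alpha -> completable a b alpha.

End Topology.

(* Main.v *)
Require Import Defs.
From mathcomp Require Import all_boot all_order all_algebra.
From mathcomp Require Import all_classical all_reals all_analysis.
From mathcomp Require Import lra.
Import Order.TTheory GRing.Theory Num.Theory.
Import numFieldNormedType.Exports.

(** If [X] is compact, then a definable curve has a cluster point at each end, and
    by o-minimality this is a limit ([compact_definably_compact]).

    The converse avoids dimension theory, cell decomposition and curve selection.

    In affine space, let [K] be definable and suppose that definable maps from
    intervals to [K] have limits in [K]. The image of [K] by a coordinate is a
    finite union of points and open intervals; definable choice lifts such an
    interval to [K], and the limits of the lift show that the ends of the interval
    belong to the image, which is therefore compact ([compact_coord]). Applied to
    the intersections of [K] with closed boxes, this allows to fix one by one the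
    coordinates of a point in the closure of [K], so [K] is closed
    ([ends_in_closed]); being contained in a product of compact sets, it is compact
    ([ends_in_compact]).

    In [X], a closed definable subset [E] of one chart domain is compact, since the
    affine case applies to its image ([compact_closed_in_chart]). Definable
    compactness of [X] speaks of continuous curves only, while definable choice
    gives arbitrary definable maps; the gap is filled by the fact that a definable
    map on an interval is continuous near the ends ([eventually_continuous]), which
    over the reals follows from a countability argument.

    Finally, let [Z] be closed and definable and suppose that the part of [Z]
    outside one chart domain is compact. Finitely many definable open sets of a
    given basis cover this part, and the rest of [Z] is closed, definable and inside
    the chart domain, hence compact; so [Z] is compact ([compact_absorb]). Removing
    the chart domains from [X] one by one reaches the empty set, and the last step
    applied backwards gives the compactness of [X]. *)

Set Implicit Arguments.
Unset Strict Implicit.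
Unset Printing Implicit Defensive.

Local Open Scope classical_set_scope.
Local Open Scope ring_scope.

(** * Closure properties of definable sets *)

Section Renaming.
Variables (R : realType) (M : expansion R).

Fixpoint rename_term n m (f : 'I_n -> 'I_m) (t : term M n) : term M m :=
  match t with
  | Var i => Var M (f i)
  | App g ts => App (fun i => rename_term f (ts i))
  end.

Definition rename_under n m (f : 'I_n -> 'I_m) (i : 'I_(n + 1)) : 'I_(m + 1) :=
  match fintype.split i with
  | inl j => lshift 1 (f j)
  | inr j => rshift m j
  end.

(** Every closure property of definable sets that moves variables around (merging
    two rows of parameters, permuting or identifying coordinates, substituting
    constants) is an instance of renaming the free variables of a formula. *)
Fixpoint rename n (p : formula M n) : forall m, ('I_n -> 'I_m) -> formula M m :=
  match p with
  | Eq n s t => fun m f => Eq (rename_term f s) (rename_term f t)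
  | Lt n s t => fun m f => Lt (rename_term f s) (rename_term f t)
  | Rel n r ts => fun m f => Rel (fun i => rename_term f (ts i))
  | Not n p => fun m f => Not (rename p f)
  | And n p q => fun m f => And (rename p f) (rename q f)
  | Ex n p => fun m f => Ex (rename p (rename_under f))
  end.

Lemma eval_rename n m (f : 'I_n -> 'I_m) (t : term M n) (v : 'rV[R]_m) :
  Defs.eval v (rename_term f t) = Defs.eval (\row_i v ord0 (f i)) t.
Proof.
elim: t => [i|g ts ih] /=; first by rewrite mxE.
by congr fun_val; apply/rowP => i; rewrite !mxE.
Qed.

Lemma sat_rename n (p : formula M n) m (f : 'I_n -> 'I_m) (v : 'rV[R]_m) :
  sat (rename p f) v <-> sat p (\row_i v ord0 (f i)).
Proof.
elim: p m f v => {n} [n s t|n s t|n r ts|n p ih|n p ihp q ihq|n p ih] m f v /=.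
- by rewrite !eval_rename.
- by rewrite !eval_rename.
- suff -> : \row_i Defs.eval v (rename_term f (ts i)) =
    \row_i Defs.eval (\row_j v ord0 (f j)) (ts i) by [].
  by apply/rowP => i; rewrite !mxE eval_rename.
- by rewrite ih.
- by rewrite ihp ihq.
- have row_under y : \row_i row_mx v (const_mx y : 'rV_1) ord0 (rename_under f i) =
      row_mx (\row_i v ord0 (f i)) (const_mx y).
    apply/rowP => i; rewrite !mxE /rename_under.
    by case: (fintype.split i) => j; rewrite ?(unsplitK (inl _)) ?(unsplitK (inr _)) !mxE.
  by split=> -[y py]; exists y; move: py; rewrite ih row_under.
Qed.

End Renaming.

Section DefinableClosure.
Variables (R : realType) (M : expansion R).

(** Interpretations of the terms that are a variable or a constant: the only
    substitutions for which renaming variables and adding parameters suffices. *)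
Definition atomic n (g : 'rV[R]_n -> R) : Prop :=
  exists u : 'I_n + R, forall x, g x = match u with inl i => x ord0 i | inr c => c end.

Lemma atomic_coord n (i : 'I_n) : atomic (fun x => x ord0 i).
Proof. by exists (inl i). Qed.

Lemma atomic_const n (c : R) : atomic (fun _ : 'rV_n => c).
Proof. by exists (inr c). Qed.

Lemma definable_preimage m n (A : set 'rV[R]_m) (g : 'rV[R]_n -> 'rV[R]_m) :
  definable M A -> (forall i, atomic (fun x => g x ord0 i)) ->
  definable M [set x | A (g x)].
Proof.
move=> [k [c [p ->]]] /choice[u gu].
(* The constants among the coordinates of [g] become [m] further parameters,
   placed after the [k] parameters of [A]. *)
pose f (i : 'I_(m + k)) : 'I_(n + (k + m)) :=
  match fintype.split i with
  | inl j => match u j with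
             | inl l => lshift (k + m) l
             | inr _ => rshift n (rshift k j)
             end
  | inr j => rshift n (lshift m j)
  end.
pose d : 'rV[R]_m := \row_j match u j with inl _ => 0 | inr a => a end.
exists (k + m)%N, (row_mx c d), (rename p f).
apply/seteqP; split=> x /=; rewrite sat_rename.
all: suff -> : \row_i row_mx x (row_mx c d) ord0 (f i) = row_mx (g x) c by [].
all: apply/rowP => i; rewrite !mxE /f.
all: case: (fintype.split i) => j; last by rewrite (unsplitK (inr _)) !mxE (unsplitK (inl _)).
all: rewrite gu; case uj: (u j) => [l|a]; first by rewrite (unsplitK (inl _)).
all: by rewrite (unsplitK (inr _)) !mxE (unsplitK (inr _)) mxE uj.
Qed.

Lemma definableC n (A : set 'rV[R]_n) : definable M A -> definable M (~` A).
Proof. by move=> [k [c [p ->]]]; exists k, c, (Not p). Qed.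

Lemma definableI n (A B : set 'rV[R]_n) :
  definable M A -> definable M B -> definable M (A `&` B).
Proof.
move=> [k [c [p ->]]] [l [d [q ->]]].
pose f (i : 'I_(n + k)) : 'I_(n + (k + l)) :=
  match fintype.split i with
  | inl j => lshift (k + l) j
  | inr j => rshift n (lshift l j)
  end.
pose g (i : 'I_(n + l)) : 'I_(n + (k + l)) :=
  match fintype.split i with
  | inl j => lshift (k + l) j
  | inr j => rshift n (rshift k j)
  end.
exists (k + l)%N, (row_mx c d), (And (rename p f) (rename q g)).
have fE x : \row_i row_mx x (row_mx c d) ord0 (f i) = row_mx x c.
  apply/rowP => i; rewrite !mxE /f.
  by case: (fintype.split i) => j; rewrite ?(unsplitK (inl _)) ?(unsplitK (inr _)) // !mxE (unsplitK (inl _)).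
have gE x : \row_i row_mx x (row_mx c d) ord0 (g i) = row_mx x d.
  apply/rowP => i; rewrite !mxE /g.
  by case: (fintype.split i) => j; rewrite ?(unsplitK (inl _)) ?(unsplitK (inr _)) // !mxE (unsplitK (inr _)).
by apply/seteqP; split=> x /=; rewrite !sat_rename fE gE.
Qed.

Lemma definable_and n (P Q : 'rV[R]_n -> Prop) :
  definable M [set x | P x] -> definable M [set x | Q x] ->
  definable M [set x | P x /\ Q x].
Proof. exact: definableI. Qed.

Lemma definable_not n (P : 'rV[R]_n -> Prop) :
  definable M [set x | P x] -> definable M [set x | ~ P x].
Proof. exact: definableC. Qed.

Lemma definable_imply n (P Q : 'rV[R]_n -> Prop) :
  definable M [set x | P x] -> definable M [set x | Q x] ->
  definable M [set x | P x -> Q x].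
Proof.
move=> dP dQ; suff -> : [set x | P x -> Q x] = [set x | ~ (P x /\ ~ Q x)].
  exact/definable_not/definable_and/definable_not.
apply/seteqP; split=> x /=; first by move=> PQ [/PQ].
by move=> nPQ Px; apply: contrapT => nQ; exact: nPQ.
Qed.

(** The bound variable comes last in [Ex], whereas the parameters come last in
    [definable]: the proof renames one position into the other. *)
Lemma definable_ex n (P : 'rV[R]_n -> R -> Prop) :
  definable M [set z : 'rV_(n + 1) | P (lsubmx z) (z ord0 (rshift n ord0))] ->
  definable M [set x | exists y, P x y].
Proof.
move=> [k [c [p eP]]].
pose f (i : 'I_(n + 1 + k)) : 'I_(n + k + 1) :=
  match fintype.split i with
  | inl j => match fintype.split j with
             | inl l => lshift 1 (lshift k l)
             | inr l => rshift (n + k) l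
             end
  | inr j => lshift 1 (rshift n j)
  end.
exists k, c, (Ex (rename p f)).
have fE x y : \row_i row_mx (row_mx x c) (const_mx y : 'rV_1) ord0 (f i) =
    row_mx (row_mx x (const_mx y)) c.
  apply/rowP => i; rewrite !mxE /f; case: (fintype.split i) => j; last first.
    by rewrite (unsplitK (inl _)) mxE (unsplitK (inr _)).
  rewrite !mxE; case: (fintype.split j) => l.
    by rewrite (unsplitK (inl _)) mxE (unsplitK (inl _)).
  by rewrite (unsplitK (inr _)).
have PE x y : P x y <-> sat p (row_mx (row_mx x (const_mx y)) c).
  have : [set z : 'rV_(n + 1) | P (lsubmx z) (z ord0 (rshift n ord0))]
    (row_mx x (const_mx y)) <-> [set z | sat p (row_mx z c)]
    (row_mx x (const_mx y)) by rewrite eP.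
  by rewrite /= row_mxKl row_mxEr mxE.
by apply/seteqP; split=> x /= -[y]; [move=> /PE|]; rewrite ?sat_rename => Py;
  exists y; [rewrite sat_rename fE|apply/PE; rewrite -fE].
Qed.

Lemma definable_all n (P : 'rV[R]_n -> R -> Prop) :
  definable M [set z : 'rV_(n + 1) | P (lsubmx z) (z ord0 (rshift n ord0))] ->
  definable M [set x | forall y, P x y].
Proof.
move=> dP; suff -> : [set x | forall y, P x y] = [set x | ~ exists y, ~ P x y].
  exact/definable_not/definable_ex/definable_not.
apply/seteqP; split=> x /=; first by move=> Px [y]; apply.
by move=> nPx y; apply: contrapT => nP; apply: nPx; exists y.
Qed.

Lemma definable_ex_row n m (G : 'rV[R]_n -> 'rV[R]_m -> Prop) :
  definable M [set z : 'rV_(n + m) | G (lsubmx z) (rsubmx z)] ->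
  definable M [set x | exists y, G x y].
Proof.
elim: m n G => [|m ih] n G dG.
  suff -> : [set x | exists y, G x y] = [set x : 'rV[R]_n | G x 0].
    have -> : [set x : 'rV[R]_n | G x 0] =
        [set x : 'rV[R]_n | [set z : 'rV_(n + 0) | G (lsubmx z) (rsubmx z)] (row_mx x 0)].
      by apply/seteqP; split=> x /=; rewrite row_mxKl row_mxKr.
    apply: definable_preimage dG _ => i.
    case: (fintype.splitP i) => [j ij|[]//].
    exists (inl j) => x; rewrite -(row_mxEl x (0 : 'rV_0) ord0 j).
    by congr (row_mx _ _ _ _); exact/val_inj.
  apply/seteqP; split=> x /=; last by exists 0.
  by move=> [y]; rewrite (_ : y = 0)//; apply/rowP => -[].
have dG' : definable M [set x : 'rV[R]_(n + 1) | exists y : 'rV_m,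
    G (lsubmx x) (row_mx (rsubmx x) y)].
  apply: ih.
  pose g (z : 'rV[R]_(n + 1 + m)) : 'rV[R]_(n + (1 + m)) :=
    row_mx (lsubmx (lsubmx z)) (row_mx (rsubmx (lsubmx z)) (rsubmx z)).
  rewrite (_ : mkset _ = [set z | [set z : 'rV_(n + (1 + m)) |
      G (lsubmx z) (rsubmx z)] (g z)]); last first.
    by apply/seteqP; split=> z /=; rewrite row_mxKl row_mxKr.
  apply: definable_preimage dG _ => i; case: (split_ordP i) => j ->.
    by exists (inl (lshift m (lshift 1 j))) => z; rewrite row_mxEl !mxE.
  case: (@split_ordP 1 m j) => l ->.
    by exists (inl (lshift m (rshift n l))) => z; rewrite row_mxEr (@row_mxEl _ 1 1 m) !mxE.
  by exists (inl (rshift (n + 1) l)) => z; rewrite row_mxEr (@row_mxEr _ 1 1 m) !mxE.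
pose P (x : 'rV[R]_n) (y0 : R) :=
  exists y : 'rV_m, G x (row_mx (const_mx y0 : 'rV_1) y).
have /definable_ex : definable M [set z : 'rV[R]_(n + 1) |
    P (lsubmx z) (z ord0 (rshift n ord0))].
  rewrite (_ : mkset _ = [set x : 'rV[R]_(n + 1) | exists y : 'rV_m,
    G (lsubmx x) (row_mx (rsubmx x) y)])//.
  have cE (z : 'rV[R]_(n + 1)) : const_mx (z ord0 (rshift n ord0)) = rsubmx z.
    by apply/rowP => j; rewrite !mxE (ord1 j).
  by apply/seteqP; split=> z /=; rewrite /P cE.
rewrite (_ : mkset _ = [set x | exists y : 'rV_(m.+1), G x y])//.
apply/seteqP; split=> x /=; first by move=> [y0 [y Gy]]; eexists; exact: Gy.
move=> [y Gy]; exists ((y : 'rV_(1 + m)) ord0 (lshift m ord0)), (rsubmx (y : 'rV_(1 + m))).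
suff -> : const_mx ((y : 'rV_(1 + m)) ord0 (lshift m ord0)) = lsubmx (y : 'rV_(1 + m)).
  by rewrite hsubmxK.
by apply/rowP => j; rewrite !mxE (ord1 j).
Qed.

Lemma definable_lt_vars : definable M [set z : 'rV[R]_2 | z ord0 ord0 < z ord0 ord_max].
Proof.
exists 0%N, 0, (Lt (Var M (lshift 0 ord0 : 'I_(2 + 0))) (Var M (lshift 0 ord_max))).
by apply/seteqP; split=> z /=; rewrite !row_mxEl.
Qed.

Lemma definable_eq_vars : definable M [set z : 'rV[R]_2 | z ord0 ord0 = z ord0 ord_max].
Proof.
exists 0%N, 0, (Eq (Var M (lshift 0 ord0 : 'I_(2 + 0))) (Var M (lshift 0 ord_max))).
by apply/seteqP; split=> z /=; rewrite !row_mxEl.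
Qed.

Definition pair_row (s t : R) : 'rV[R]_2 := \row_i if i == ord0 then s else t.

Lemma atomic_pair_row n (g h : 'rV[R]_n -> R) : atomic g -> atomic h ->
  forall i, atomic (fun x => pair_row (g x) (h x) ord0 i).
Proof.
move=> [u gu] [v hv] i; exists (if i == ord0 then u else v) => x.
by rewrite mxE; case: ifP.
Qed.

Lemma definable_lt n (g h : 'rV[R]_n -> R) : atomic g -> atomic h ->
  definable M [set x | g x < h x].
Proof.
move=> ag ah.
have := definable_preimage definable_lt_vars (atomic_pair_row ag ah).
by rewrite (_ : mkset _ = [set x | g x < h x])//; apply/seteqP; split=> x /=; rewrite !mxE.
Qed.

Lemma definable_eq n (g h : 'rV[R]_n -> R) : atomic g -> atomic h ->
  definable M [set x | g x = h x].
Proof.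
move=> ag ah.
have := definable_preimage definable_eq_vars (atomic_pair_row ag ah).
by rewrite (_ : mkset _ = [set x | g x = h x])//; apply/seteqP; split=> x /=; rewrite !mxE.
Qed.

Lemma definableT n : definable M [set: 'rV[R]_n].
Proof.
have := @definable_eq n (fun=> 0) (fun=> 0) (atomic_const _ _) (atomic_const _ _).
by rewrite (_ : mkset _ = setT)//; apply/seteqP; split.
Qed.

Lemma definable_forall_ord n m (P : 'I_m -> 'rV[R]_n -> Prop) :
  (forall j, definable M [set x | P j x]) -> definable M [set x | forall j, P j x].
Proof.
move=> dP.
have big (s : seq 'I_m) : definable M [set x | forall j, j \in s -> P j x].
  elim: s => [|j s ih].
    by rewrite (_ : mkset _ = setT); [exact: definableT|apply/seteqP; split].
  rewrite (_ : mkset _ = [set x | P j x] `&` [set x | forall j, j \in s -> P j x]).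
    exact: definableI.
  apply/seteqP; split=> x /=.
    by move=> Px; split=> [|l ls]; apply: Px; rewrite inE ?eqxx// ls orbT.
  by move=> [Pj Ps] l; rewrite inE => /predU1P[->|/Ps].
have := big (enum 'I_m); rewrite (_ : mkset _ = [set x | forall j, P j x])//.
by apply/seteqP; split=> x /= Px j; [apply: Px; rewrite mem_enum|move=> _; exact: Px].
Qed.

Lemma definable_lte n (a : \bar R) (g : 'rV[R]_n -> R) : atomic g ->
  definable M [set x | (a < (g x)%:E)%E].
Proof.
move=> ag; case: a => [r||].
- exact: (definable_lt (atomic_const _ r) ag).
- rewrite (_ : mkset _ = ~` setT); first exact/definableC/definableT.
  by apply/seteqP; split=> x //=; rewrite ltNge leey.
- rewrite (_ : mkset _ = setT); first exact/definableT.
  by apply/seteqP; split=> x //= _; rewrite ltNyr.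
Qed.

Lemma definable_gte n (a : \bar R) (g : 'rV[R]_n -> R) : atomic g ->
  definable M [set x | ((g x)%:E < a)%E].
Proof.
move=> ag; case: a => [r||].
- exact: (definable_lt ag (atomic_const _ r)).
- rewrite (_ : mkset _ = setT); first exact/definableT.
  by apply/seteqP; split=> x //= _; rewrite ltry.
- rewrite (_ : mkset _ = ~` setT); first exact/definableC/definableT.
  by apply/seteqP; split=> x //=; rewrite ltNge leNye.
Qed.

Lemma definable_itv n (a b : \bar R) (g : 'rV[R]_n -> R) : atomic g ->
  definable M [set x | (a < (g x)%:E < b)%E].
Proof.
move=> ag; rewrite (_ : mkset _ = [set x | (a < (g x)%:E)%E] `&` [set x | ((g x)%:E < b)%E]).
  by apply: definableI; [exact: definable_lte|exact: definable_gte].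
by apply/seteqP; split=> x /=; [move=> /andP[]|move=> [-> ->]].
Qed.

Lemma atomic_row_mx n m p (g : 'rV[R]_n -> 'rV[R]_m) (h : 'rV[R]_n -> 'rV[R]_p) :
  (forall i, atomic (fun x => g x ord0 i)) ->
  (forall i, atomic (fun x => h x ord0 i)) ->
  forall i, atomic (fun x => row_mx (g x) (h x) ord0 i).
Proof.
move=> ag ah i; case: (split_ordP i) => j ->.
  by have [u gu] := ag j; exists u => x; rewrite row_mxEl.
by have [u hu] := ah j; exists u => x; rewrite row_mxEr.
Qed.

End DefinableClosure.

(** Proves [atomic] for a projection, once submatrix operations are computed. *)
Ltac coordinate := eexists (inl _) => ?; rewrite ?mxE; reflexivity.

(** * The ends of an open interval *)

Section EndFilters.
Variable R : realType.
Implicit Types (a b : \bar R) (F : set_system R).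

(** Quantifying over [F] treats the two ends of the interval, finite or not, at
    once. *)
Definition end_filter a b F := F = right_of a \/ F = left_of b.

Lemma end_filter_proper a b F : end_filter a b F -> ProperFilter F.
Proof.
by move=> [->|->]; [case: a => [r| |]|case: b => [r| |]];
  rewrite /right_of /left_of; exact: _.
Qed.

Lemma between a b : (a < b)%E -> exists t : R, (a < t%:E < b)%E.
Proof.
move: a b => [r| |] [s| |] //= ab.
- by exists ((r + s) / 2); move: ab; rewrite !lte_fin => ab; apply/andP; split; lra.
- by exists (r + 1); rewrite ltry lte_fin ltrDl ltr01.
- by exists (s - 1); rewrite ltNyr lte_fin ltrBlDr ltrDl ltr01.
- by exists 0; rewrite ltNyr ltry.
Qed.

(** Near an end of an interval a property holds on a whole subinterval with the
    same end, so a curve may be cut down to where it behaves well. *)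
Lemma end_filter_itv a b F (P : set R) : (a < b)%E -> end_filter a b F ->
  (\forall t \near F, P t) ->
  exists a' b', [/\ (a' < b')%E, end_filter a' b' F &
    forall t, (a' < t%:E < b')%E -> (a < t%:E < b)%E /\ P t].
Proof.
move=> ab [->{F}|->{F}].
  case: a ab => [r| |] ab; last 2 first.
  - by move: ab; rewrite ltNge leey.
  - move=> [m [_ mP]]; exists (-oo)%E, (Order.min b m%:E).
    split; [|by left|].
      by rewrite lt_min ab ltNyr.
    move=> t; rewrite lt_min => /and3P[rt tb tm]; rewrite rt tb; split=> //.
    by apply: mP; rewrite -lte_fin.
  - rewrite /right_of => -[/= e e0 eP]; exists r%:E, (Order.min b (r + e)%:E).
    split; [|by left|].
      by rewrite lt_min ab lte_fin ltrDl.
    move=> t; rewrite lt_min => /and3P[rt tb te]; rewrite rt tb; split=> //.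
    move: rt te; rewrite !lte_fin => rt te; apply: eP => //=.
    rewrite ltr0_norm; lra.
case: b ab => [r| |] ab; last by move: ab; rewrite ltNge leNye.
  rewrite /left_of => -[/= e e0 eP]; exists (Order.max a (r - e)%:E), r%:E.
  split; [|by right|].
    by rewrite gt_max ab lte_fin ltrBlDr ltrDl.
  move=> t; rewrite gt_max => /andP[/andP[at_ te] tr]; rewrite at_ tr; split=> //.
  move: te tr; rewrite !lte_fin => te tr; apply: eP => //=.
  rewrite gtr0_norm; lra.
move=> [m [_ mP]]; exists (Order.max a m%:E), +oo%E.
split; [|by right|].
  by rewrite gt_max ab ltry.
move=> t; rewrite gt_max => /andP[/andP[at_ tm] tr]; rewrite at_ tr; split=> //.
by apply: mP; rewrite -lte_fin.
Qed.

Lemma end_filter_near a b F : (a < b)%E -> end_filter a b F ->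
  \forall t \near F, (a < t%:E < b)%E.
Proof.
move=> ab [->{F}|->{F}].
  case: a ab => [r| |] ab; rewrite /right_of; last 2 first.
  - by move: ab; rewrite ltNge leey.
  - case: b ab => [s| |] ab; last by move: ab; rewrite ltxx.
      by near=> t; rewrite ltNyr lte_fin/=; near: t; exact: nbhs_ninfty_lt.
    by near=> t; rewrite ltNyr ltry.
  - have tb : \forall t \near r^'+, (t%:E < b)%E.
      case: b ab => [s| |] ab.
      + by move: ab; rewrite lte_fin => /nbhs_right_lt; apply: filterS => t.
      + by apply: filterE => t; rewrite ltry.
      + by move: ab; rewrite ltNge leNye.
    by apply: filterS2 (nbhs_right_gt r) tb => t rt ->; rewrite lte_fin rt.
case: b ab => [r| |] ab; rewrite /left_of; last by move: ab; rewrite ltNge leNye.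
  have at_ : \forall t \near r^'-, (a < t%:E)%E.
    case: a ab => [s| |] ab.
    + by move: ab; rewrite lte_fin => /nbhs_left_gt; apply: filterS => t.
    + by move: ab; rewrite ltNge leey.
    + by apply: filterE => t; rewrite ltNyr.
  by apply: filterS2 (nbhs_left_lt r) at_ => t rt ->; rewrite lte_fin rt.
case: a ab => [s| |] ab; [|by move: ab; rewrite ltxx|].
  by near=> t; rewrite ltry andbT lte_fin/=; near: t; exact: nbhs_pinfty_gt.
by near=> t; rewrite ltNyr ltry.
Unshelve. all: by end_near. Qed.

Lemma end_filter_cut a b F c : end_filter a b F ->
  (\forall t \near F, t < c) \/ (\forall t \near F, c < t).
Proof.
move=> [->{F}|->{F}].
  case: a => [r| |]; rewrite /right_of.
  - have [cr|rc] := leP c r; [right|left].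
      by near=> t; apply: le_lt_trans cr _; near: t; exact: nbhs_right_gt.
    exact: nbhs_right_lt.
  - by right; exact: (nbhs_pinfty_gt (num_real c)).
  - by left; exact: (nbhs_ninfty_lt (num_real c)).
case: b => [r| |]; rewrite /left_of.
- have [rc|cr] := leP r c; [left|right].
    by near=> t; apply: lt_le_trans rc; near: t; exact: nbhs_left_lt.
  exact: nbhs_left_gt.
- by right; exact: (nbhs_pinfty_gt (num_real c)).
- by left; exact: (nbhs_ninfty_lt (num_real c)).
Unshelve. all: by end_near. Qed.

(** Recovers an end of an interval as a real number, from the limit of a map
    which is the identity on the interval. *)
Lemma end_filter_lim a b F (l : R) :
  (a < b)%E -> end_filter a b F -> F --> l ->
  (F = right_of a -> a = l%:E) /\ (F = left_of b -> b = l%:E).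
Proof.
move=> ab endF Fl; have FF := end_filter_proper endF.
have le_l m : (\forall t \near F, t < m) -> l <= m.
  move=> Fm; rewrite leNgt; apply/negP => ml.
  have Fgt : \forall t \near F, m < t by apply: Fl; exact: lt_nbhsr.
  by have [t [tm /(lt_trans tm)]] := filter_ex (filterI Fm Fgt); rewrite ltxx.
have ge_l m : (\forall t \near F, m < t) -> m <= l.
  move=> Fm; rewrite leNgt; apply/negP => ml.
  have Flt : \forall t \near F, t < m by apply: Fl; exact: lt_nbhsl.
  by have [t [tm /(lt_trans tm)]] := filter_ex (filterI Flt Fm); rewrite ltxx.
have Fab := end_filter_near ab endF.
split=> FE; apply/eqP; rewrite eq_le; apply/andP; split; rewrite leNgt; apply/negP.
- move=> /between[m /andP[]]; rewrite lte_fin => lm ma.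
  have : m <= l.
    apply: ge_l; apply: filterS Fab => t /andP[at_ _].
    by rewrite -lte_fin (lt_trans ma at_).
  by rewrite leNgt lm.
- move=> /between[m /andP[am]]; rewrite lte_fin => ml.
  have : l <= m.
    have : end_filter a m%:E F by left.
    move/(end_filter_near am) => Fm; apply: le_l; apply: filterS Fm => t /andP[_].
    by rewrite lte_fin.
  by rewrite leNgt ml.
- move=> /between[m /andP[]]; rewrite lte_fin => lm mb.
  have : m <= l.
    have : end_filter m%:E b F by right.
    move/(end_filter_near mb) => Fm; apply: ge_l; apply: filterS Fm => t /andP[+ _].
    by rewrite lte_fin.
  by rewrite leNgt lm.
- move=> /between[m /andP[bm]]; rewrite lte_fin => ml.
  have : l <= m.
    apply: le_l; apply: filterS Fab => t /andP[_ tb].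
    by rewrite -lte_fin (lt_trans tb bm).
  by rewrite leNgt ml.
Qed.

End EndFilters.

(** * Definable functions on an interval *)

Section OMinimal.
Variables (R : realType) (M : expansion R).
Hypothesis hM : o_minimal M.

(** Points and intervals have this property by [end_filter_cut], and it is stable
    under finite unions: on definable sets an end filter is an ultrafilter. *)
Lemma o_minimal_eventually a b F (A : set 'rV[R]_1) : end_filter a b F ->
  definable M A ->
  (\forall t \near F, A (const_mx t)) \/ (\forall t \near F, ~ A (const_mx t)).
Proof.
move=> endF /hM[pts [itvs ->]]; have FF := end_filter_proper endF.
pose dec (P : set R) := (\forall t \near F, P t) \/ (\forall t \near F, ~ P t).
have decU (P Q : set R) : dec P -> dec Q -> dec (fun t => P t \/ Q t).
  move=> [dP _|dP [dQ|dQ]].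
  - by left; apply: filterS dP => t; left.
  - by left; apply: filterS dQ => t; right.
  - by right; apply: filterS2 dP dQ => t nP nQ [].
have decI (P Q : set R) : dec P -> dec Q -> dec (fun t => P t /\ Q t).
  move=> [dP [dQ|dQ]|dP _].
  - by left; apply: filterS2 dP dQ.
  - by right; apply: filterS dQ => t nQ [].
  - by right; apply: filterS dP => t nP [].
have dec_ext (P Q : set R) : (forall t, P t <-> Q t) -> dec P -> dec Q.
  by move=> PQ [] d; [left|right]; apply: filterS d => t; rewrite PQ.
have dec_pt c : dec (fun t => t = c).
  right; have [d|d] := end_filter_cut c endF; apply: filterS d => t /[swap] ->;
  by rewrite ltxx.
have dec_gt c : dec (fun t => (c < t%:E)%E).
  case: c => [c| |].
  - have [d|d] := end_filter_cut c endF; [right|left]; apply: filterS d => t.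
      by rewrite lte_fin => tc ct; have := lt_trans tc ct; rewrite ltxx.
    by rewrite lte_fin.
  - by right; apply: filterE => t; rewrite ltNge leey.
  - by left; apply: filterE => t; rewrite ltNyr.
have dec_lt c : dec (fun t => (t%:E < c)%E).
  case: c => [c| |].
  - have [d|d] := end_filter_cut c endF; [left|right]; apply: filterS d => t.
      by rewrite lte_fin.
    by rewrite lte_fin => tc ct; have := lt_trans tc ct; rewrite ltxx.
  - by left; apply: filterE => t; rewrite ltry.
  - by right; apply: filterE => t; rewrite ltNge leNye.
have dec_false : dec (fun=> False) by right; apply: filterE => t [].

suff : dec (fun t => t \in pts \/ exists2 ab : \bar R * \bar R, ab \in itvs &
    (ab.1 < t%:E < ab.2)%E).
  by apply: (dec_ext) => t; rewrite /= mxE.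
apply: (decU).
  elim: pts => [|p pts ih]; first by apply: (dec_ext) dec_false => t; split.
  apply: (dec_ext) (decU _ _ (dec_pt p) ih) => t; rewrite inE.
  by split=> [[->|->]|/predU1P]; rewrite ?eqxx ?orbT.
elim: itvs => [|[c d] itvs ih].
  by apply: (dec_ext) dec_false => t; split=> [|[ab]].
apply: (dec_ext) (decU _ _ (decI _ _ (dec_gt c) (dec_lt d)) ih) => t; split.
  move=> [[ct td]|[ab abs abt]]; first by exists (c, d); rewrite ?mem_head//= ct td.
  by exists ab => //; rewrite inE abs orbT.
move=> [ab]; rewrite inE => /predU1P[-> /= /andP[]|abs abt]; first by left.
by right; exists ab.
Qed.

Lemma itv_uncountable (a b : \bar R) (A : set R) : (a < b)%E ->
  [set t : R | (a < t%:E < b)%E] `<=` A -> ~ countable A.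
Proof.
move=> ab abA cA; have [q /andP[aq qb]] := between ab.
have [p /andP[ap pq]] := between aq.
have : countable `]p, q[%classic.
  apply: sub_countable cA; apply: subset_card_le => t /=.
  rewrite in_itv/= -!lte_fin => /andP[pt tq]; apply: abA => /=.
  by rewrite (lt_trans ap pt) (lt_trans tq qb).
move=> /countable_lebesgue_measure0; rewrite lebesgue_measure_itv/= pq => /eqP.
by rewrite -EFinD eqe subr_eq0 gt_eqF// -lte_fin.
Qed.

Lemma near_itv (a b : \bar R) (t : R) : (a < t%:E < b)%E ->
  \forall x \near t, (a < x%:E < b)%E.
Proof.
move=> /andP[/between[p /andP[ap pt]] /between[q /andP[tq qb]]].
rewrite !lte_fin in pt tq; near=> x; apply/andP; split.
  by apply: lt_trans ap _; rewrite lte_fin; near: x; exact: lt_nbhsr.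
by apply: lt_trans qb; rewrite lte_fin; near: x; exact: lt_nbhsl.
Unshelve. all: by end_near. Qed.

Definition definable_on (a b : \bar R) n (f : R -> 'rV[R]_n) := definable M
  [set row_mx (const_mx t : 'rV_1) (f t) | t in [set t | (a < t%:E < b)%E]].

(** Over the reals, the part of the monotonicity theorem that matters here has a
    short proof. The preimage by a definable [g] of an interval with rational
    ends is a finite union of points and open intervals, so only finitely many of
    its points are not interior to it. As [g] is continuous at a point which is
    interior to all these preimages that contain it, [g] has countably many
    discontinuities. The set [jump] of discontinuities is definable and contains
    no interval, so it stays away from the ends. *)
Section Scalar.
Variables (a b : \bar R) (g : R -> R).
Let graph t y := (a < t%:E < b)%E /\ y = g t.
Hypothesis dg : definable M [set z : 'rV[R]_2 | graph (z ord0 ord0) (z ord0 ord_max)].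

Let definable_graph n (h k : 'rV[R]_n -> R) : atomic h -> atomic k ->
  definable M [set x | graph (h x) (k x)].
Proof.
move=> ah ak; have := definable_preimage dg (atomic_pair_row ah ak).
by congr (definable M _); apply/seteqP; split=> x /=; rewrite !mxE.
Qed.

Let jump t := exists y s u, [/\ graph t y, s < y, y < u &
  forall p q, p < t -> t < q -> exists t' y', [/\ p < t', t' < q, graph t' y' &
    ~ (s < y' /\ y' < u)]].

(* [jump] is written with the order and the graph only, so that its definition
   can be read as a formula. *)
Let definable_jump : definable M [set x : 'rV[R]_1 | jump (x ord0 ord0)].
Proof.
have and4 (P Q S T : Prop) : [/\ P, Q, S & T] = (P /\ Q /\ S /\ T).
  by rewrite propeqE; split=> [[]|[? [? []]]].
rewrite /jump; do 3 (apply: definable_ex).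
under [X in definable M X]eq_set do rewrite and4.
apply: definable_and.
  by apply: definable_graph; coordinate.
apply: definable_and.
  by apply: definable_lt; coordinate.
apply: definable_and.
  by apply: definable_lt; coordinate.
do 2 (apply: definable_all).
apply: definable_imply.
  by apply: definable_lt; coordinate.
apply: definable_imply.
  by apply: definable_lt; coordinate.
do 2 (apply: definable_ex).
under [X in definable M X]eq_set do rewrite and4.
apply: definable_and.
  by apply: definable_lt; coordinate.
apply: definable_and.
  by apply: definable_lt; coordinate.
apply: definable_and.
  by apply: definable_graph; coordinate.
apply: definable_not; apply: definable_and;
  by apply: definable_lt; coordinate.
Qed.

Let countable_jump : countable [set t | jump t].
Proof.
pose A (q : rat * rat) t :=
  [/\ (a < t%:E < b)%E, ratr q.1 < g t & g t < ratr q.2].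
pose B q := [set t | A q t /\
  forall p r, p < t -> t < r -> exists t', [/\ p < t', t' < r & ~ A q t']].
have jumpB : [set t | jump t] `<=` \bigcup_q B q.
  move=> t [_ [s [u [[abt ->] sg gu jt]]]].
  have [p] := rat_in_itvoo sg; rewrite in_itv/= => /andP[sp pg].
  have [r] := rat_in_itvoo gu; rewrite in_itv/= => /andP[gr ru].
  exists (p, r) => //; split=> [//|x y xt ty].
  have [t' [_ [xt' t'y [_ ->] ngt']]] := jt _ _ xt ty.
  exists t'; split=> // -[_ /= pg' gr']; apply: ngt'.
  by rewrite (lt_trans sp pg') (lt_trans gr' ru).
apply: (sub_countable (subset_card_le jumpB)).
apply: bigcup_countable => [|q _]; first exact: countableP.
have dA : definable M [set x : 'rV[R]_1 | A q (x ord0 ord0)].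
  rewrite (_ : mkset _ = [set x : 'rV[R]_1 | exists y, graph (x ord0 ord0) y /\
      (ratr q.1 < y /\ y < ratr q.2)]).
    apply: definable_ex; apply: definable_and; last apply: definable_and.
    - by apply: definable_graph; coordinate.
    - by apply: definable_lt; [exact: atomic_const|coordinate].
    - by apply: definable_lt; [coordinate|exact: atomic_const].
  apply/seteqP; split=> x /=.
    by move=> [abx qg gq]; exists (g (x ord0 ord0)).
  by move=> [_ [[abx ->] [qg gq]]].
have [pts [itvs AE]] := hM dA.
have {}AE t : A q t <-> t \in pts \/
    exists2 ab, ab \in itvs & (ab.1 < t%:E < ab.2)%E.
  by have := congr1 (fun S => S (const_mx t)) AE; rewrite /= mxE => ->.
(* A point of an open interval contained in [A q] is not in [B q]. *)
apply: finite_set_countable; apply: sub_finite_set (finite_seq pts).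
move=> t [At Bt] /=; have /AE[//|[[c d] cd /= /andP[]]] := At.
move=> /between[p /andP[cp pt]] /between[r /andP[tr rd]].
rewrite !lte_fin in pt tr.
have [t' [pt' t'r]] := Bt _ _ pt tr; case; apply/AE; right.
exists (c, d) => //=; rewrite -lte_fin in pt'; rewrite -lte_fin in t'r.
by rewrite (lt_trans cp pt') (lt_trans t'r rd).
Qed.

Let continuous_nojump t : (a < t%:E < b)%E -> ~ jump t -> {for t, continuous g}.
Proof.
move=> abt njt; apply/cvgrPdist_lt => e e0; apply: contrapT => nc; apply: njt.
exists (g t), (g t - e), (g t + e); split=> //.
- by rewrite ltrBlDr ltrDl.
- by rewrite ltrDl.
move=> p q pt tq; apply: contrapT => npq; apply: nc.
near=> x; apply: contrapT => nx; apply: npq; exists x, (g x); split.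
- by near: x; exact: lt_nbhsr.
- by near: x; exact: lt_nbhsl.
- by split=> //; near: x; exact: near_itv.
- by move=> [gx xg]; apply: nx; rewrite ltr_norml; apply/andP; split; lra.
Unshelve. all: by end_near. Qed.

Lemma scalar_eventually_continuous F : (a < b)%E -> end_filter a b F ->
  \forall t \near F, {for t, continuous g}.
Proof.
move=> ab endF; have FF := end_filter_proper endF.
have [jF|njF] := o_minimal_eventually endF definable_jump; last first.
  apply: filterS2 njF (end_filter_near ab endF) => t /= + abt.
  by rewrite mxE; exact: continuous_nojump.
have [a' [b' [ab' _ jab]]] := end_filter_itv ab endF jF; exfalso.
apply: (itv_uncountable ab' _ countable_jump) => t /jab[_ /=].
by rewrite mxE.
Qed.

End Scalar.

Lemma definable_on_graphP a b n (f : R -> 'rV[R]_n) t y :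
  [set row_mx (const_mx t : 'rV_1) (f t) | t in [set t | (a < t%:E < b)%E]]
    (row_mx (const_mx t) y) <-> (a < t%:E < b)%E /\ y = f t.
Proof.
split=> [[s /= abs /eq_row_mx[st <-]]|[abt ->]]; last by exists t.
suff -> : t = s by [].
by have := congr1 (fun x : 'rV_1 => x ord0 ord0) st; rewrite !mxE.
Qed.

Lemma definable_on_coord a b n (f : R -> 'rV[R]_n) (j : 'I_n) :
  definable_on a b f -> definable M [set z : 'rV[R]_2 |
    (a < (z ord0 ord0)%:E < b)%E /\ z ord0 ord_max = f (z ord0 ord0) ord0 j].
Proof.
move=> df; rewrite (_ : mkset _ = [set z : 'rV[R]_2 | exists y : 'rV_n,
    [set row_mx (const_mx t : 'rV_1) (f t) | t in [set t | (a < t%:E < b)%E]]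
    (row_mx (const_mx (z ord0 ord0)) y) /\ z ord0 ord_max = y ord0 j]).
  apply: definable_ex_row; apply: definable_and.
    apply: (definable_preimage df) => i.
    by apply: atomic_row_mx => {}i; coordinate.
  by apply: definable_eq; coordinate.
apply/seteqP; split=> z /=.
  by move=> [abz zf]; exists (f (z ord0 ord0)); split=> //; apply/definable_on_graphP.
by move=> [y [/definable_on_graphP[abz ->]]].
Qed.

Lemma rV_continuousP n (f : R -> 'rV[R]_n) t :
  (forall j, {for t, continuous (fun s => f s ord0 j)}) -> {for t, continuous f}.
Proof.
move=> fc; apply/cvg_ballP => e e0.
have : \forall s \near t, forall j, ball (f t ord0 j) e (f s ord0 j).
  by apply: (@filter_forall _ _ _ (nbhs t)) => j; have /cvg_ballP/(_ e e0) := fc j.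
by apply: filterS => s sb; split=> // i j; rewrite (ord1 i).
Qed.

Lemma eventually_continuous a b F n (f : R -> 'rV[R]_n) : (a < b)%E ->
  end_filter a b F -> definable_on a b f ->
  \forall t \near F, {for t, continuous f}.
Proof.
move=> ab endF df; have FF := end_filter_proper endF.
have : \forall t \near F, forall j, {for t, continuous (fun s => f s ord0 j)}.
  apply: filter_forall => j.
  exact: (@scalar_eventually_continuous a b (fun s => f s ord0 j)
    (definable_on_coord j df)).
by apply: filterS => t; exact: rV_continuousP.
Qed.

End OMinimal.

(** * Definably compact sets in affine space *)

Section Affine.
Variables (R : realType) (M : expansion R).
Hypotheses (hM : o_minimal M) (hS : definable_skolem M).

(** Definable compactness of [K], without the continuity of curves: this is the
    form that applies to the maps given by definable choice, which need not be
    continuous. *)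
Definition ends_in n (K : set 'rV[R]_n) : Prop :=
  forall (a b : \bar R) (F : set_system R) (f : R -> 'rV[R]_n),
  (a < b)%E -> end_filter a b F -> definable_on M a b f ->
  (forall t, (a < t%:E < b)%E -> K (f t)) -> exists2 x, K x & f @ F --> x.

Lemma ends_inI n (K C : set 'rV[R]_n) : closed C -> ends_in K -> ends_in (K `&` C).
Proof.
move=> clC endK a b F f ab endF df fKC; have FF := end_filter_proper endF.
have [|x Kx fx] := endK _ _ _ _ ab endF df; first by move=> t /fKC[].
exists x => //; split=> //; apply: (closed_cvg _ clC _ _ fx).
by apply: filterS (end_filter_near ab endF) => t /fKC[].
Qed.

Section Coordinate.
Variables (n : nat) (K : set 'rV[R]_n) (j : 'I_n).
Hypotheses (dK : definable M K) (endK : ends_in K).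
Let A := [set x ord0 j | x in K].

(* Definable choice gives a map [g] into [K] that is a section of the [j]-th
   coordinate over the interval; where [g] tends to, its [j]-th coordinate is the
   end of the interval. *)
Let section_end c d F : (c < d)%E -> end_filter c d F ->
  [set t | (c < t%:E < d)%E] `<=` A -> exists2 l, A l & F --> l.
Proof.
move=> cd endF cdA; have FF := end_filter_proper endF.
pose T : set 'rV[R]_1 := [set t | (c < (t ord0 ord0)%:E < d)%E].
pose G (t : 'rV[R]_1) : set 'rV[R]_n := [set x | K x /\ x ord0 j = t ord0 ord0].
have dT : definable M T by apply: definable_itv; coordinate.
have dG : definable M [set z | exists t x, [/\ T t, G t x & z = row_mx t x]].
  rewrite (_ : mkset _ = [set z : 'rV[R]_(1 + n) | T (lsubmx z) /\
      (K (rsubmx z) /\ rsubmx z ord0 j = lsubmx z ord0 ord0)]).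
    apply: definable_and; last apply: definable_and.
    - by apply: (definable_preimage dT) => i; coordinate.
    - by apply: (definable_preimage dK) => i; coordinate.
    - by apply: definable_eq; coordinate.
  apply/seteqP; split=> z /=.
    by move=> [t [x [Tt [Kx xt] ->]]]; rewrite row_mxKl row_mxKr.
  move=> [Tz [Kz zz]]; exists (lsubmx z), (rsubmx z); split=> //.
  by rewrite hsubmxK.
have [|f df fG] := hS dT dG.
  by move=> t /cdA[x Kx xt]; exists x.
pose g t := f (const_mx t).
have gG t : (c < t%:E < d)%E -> K (g t) /\ g t ord0 j = t.
  by move=> cdt; have := fG (const_mx t); rewrite /T /G/= mxE => /(_ cdt).
have dg : definable_on M c d g.
  rewrite /definable_on (_ : image _ _ = [set row_mx x (f x) | x in T])//.
  apply/seteqP; split=> _ [t /= Tt <-].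
    by exists (const_mx t) => //; rewrite /T/= mxE.
  exists (t ord0 ord0) => //; rewrite /g.
  by have -> : const_mx (t ord0 ord0) = t by apply/rowP => i; rewrite mxE (ord1 i).
have [|x Kx gx] := endK cd endF dg; first by move=> t /gG[].
exists (x ord0 j); first by exists x.
have gxj : (fun t => g t ord0 j) @ F --> x ord0 j.
  exact: (cvg_comp _ _ gx (@coord_continuous _ _ _ ord0 j x)).
move=> U xU; have gU : \forall t \near F, U (g t ord0 j) by exact: gxj.
by apply: filterS2 gU (end_filter_near cd endF) => t + /gG[_ gt]; rewrite gt.
Qed.

Let itv_ends c d : (c < d)%E -> [set t | (c < t%:E < d)%E] `<=` A ->
  exists c' d', [/\ c = c'%:E, d = d'%:E, A c' & A d'].
Proof.
move=> cd cdA.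
have [c' Ac' cc'] := section_end cd (or_introl erefl) cdA.
have [d' Ad' dd'] := section_end cd (or_intror erefl) cdA.
exists c', d'; split=> //.
  by have [+ _] := end_filter_lim cd (or_introl erefl) cc'; exact.
by have [_] := end_filter_lim cd (or_intror erefl) dd'; exact.
Qed.

(** A definable subset of the line is compact as soon as it contains the ends of
    all the open intervals that it contains. *)
Lemma compact_coord : compact A.
Proof.
have dA : definable M [set z : 'rV[R]_1 | exists x, K x /\ z ord0 ord0 = x ord0 j].
  apply: definable_ex_row; apply: definable_and.
    by apply: (definable_preimage dK) => i; coordinate.
  by apply: definable_eq; coordinate.
have [pts [itvs AE]] := hM dA.
have {}AE t : A t <-> t \in pts \/
    exists2 ab, ab \in itvs & (ab.1 < t%:E < ab.2)%E.
  have := congr1 (fun S => S (const_mx t)) AE; rewrite /= mxE => <-.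
  by split=> [[x Kx <-]|[x [Kx ->]]]; exists x.
have ->  : A = (\big[setU/set0]_(p <- pts) [set p]) `|`
  (\big[setU/set0]_(i <- itvs | (i.1 < i.2)%E) `[fine i.1, fine i.2]%classic).
  rewrite -bigcup_seq -bigcup_seq_cond; apply/seteqP; split=> [t|t].
    move=> /AE[tp|[ab abi /andP[at_ tb]]]; first by left; exists t.
    have ab12 := lt_trans at_ tb.
    right; exists ab; first by rewrite /= abi.
    have [|a' [b' [ea eb _ _]]] := itv_ends ab12.
      by move=> s abs; apply/AE; right; exists ab.
    move: at_ tb; rewrite ea eb !lte_fin /= in_itv/= => at_ tb.
    by rewrite !ltW.
  move=> [[p pp ->]|[ab /= /andP[abi ab12]]]; first by apply/AE; left.
  have abA : [set t | (ab.1 < t%:E < ab.2)%E] `<=` A.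
    by move=> s abs; apply/AE; right; exists ab.
  have [a' [b' [ea eb Aa Ab]]] := itv_ends ab12 abA.
  rewrite ea eb/= in_itv/= !le_eqVlt => /andP[/predU1P[<-//|at_]] /predU1P[->//|tb].
  by apply: abA; rewrite /= ea eb !lte_fin at_.
apply: compactU; apply: bigsetU_compact => i _.
  exact: compact_set1.
exact: segment_compact.
Qed.

End Coordinate.

Definition box n (lo hi : 'I_n -> R) : set 'rV[R]_n :=
  [set x | forall i, `[lo i, hi i]%classic (x ord0 i)].

Lemma closed_box n (lo hi : 'I_n -> R) : closed (box lo hi).
Proof.
rewrite (_ : box lo hi =
  \bigcap_(i in [set: 'I_n]) ((fun x : 'rV_n => x ord0 i) @^-1` `[lo i, hi i])).
  apply: closed_bigI => i _; apply: closed_comp; last exact: itv_closed.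
  by move=> x _; exact: coord_continuous.
by apply/seteqP; split=> x xb i; [move=> _|]; exact: xb.
Qed.

Lemma definable_box n (lo hi : 'I_n -> R) : definable M (box lo hi).
Proof.
apply: definable_forall_ord => i.
rewrite (_ : mkset _ = [set x : 'rV[R]_n | ~ (x ord0 i < lo i) /\ ~ (hi i < x ord0 i)]).
  apply: definable_and; apply: definable_not; apply: definable_lt.
  - exact: atomic_coord.
  - exact: atomic_const.
  - exact: atomic_const.
  - exact: atomic_coord.
apply/seteqP; split=> x /=; rewrite in_itv/=.
  by move=> /andP[lx xh]; split; apply/negP; rewrite -leNgt.
by move=> [/negP + /negP]; rewrite -!leNgt => -> ->.
Qed.

Lemma definable_fix n (y : 'rV[R]_n) (s : seq 'I_n) :
  definable M [set x : 'rV[R]_n | forall j, j \in s -> x ord0 j = y ord0 j].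
Proof.
apply: definable_forall_ord => j; case: (j \in s).
  rewrite (_ : mkset _ = [set x : 'rV[R]_n | x ord0 j = y ord0 j]).
    by apply: definable_eq; [exact: atomic_coord|exact: atomic_const].
  by apply/seteqP; split=> x /=; [exact|].
by rewrite (_ : mkset _ = setT); [exact: definableT|apply/seteqP; split].
Qed.

Lemma closed_fix n (y : 'rV[R]_n) (s : seq 'I_n) :
  closed [set x : 'rV[R]_n | forall j, j \in s -> x ord0 j = y ord0 j].
Proof.
rewrite (_ : mkset _ =
  \bigcap_(j in [set j | j \in s]) ((fun x : 'rV_n => x ord0 j) @^-1` [set y ord0 j])).
  apply: closed_bigI => i _; apply: closed_comp; last exact: closed_eq.
  by move=> x _; exact: coord_continuous.
by apply/seteqP; split=> x xb i; exact: xb.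
Qed.

(** The coordinates of [y] are attained one at a time. If [y] is in the closure
    of [K], then so is it in the closure of the points of [K] with [j]-th
    coordinate [y j]: for each closed box [B] around [y], the set of [j]-th
    coordinates of [K `&` B] is compact, hence closed, and it accumulates at
    [y j], hence contains it. A single curve in [K] tending to [y] would not do:
    without a group operation, a definable map relating the speeds at which two
    coordinates tend to their limits may fail to exist. *)
Lemma ends_in_closed n (K : set 'rV[R]_n) :
  definable M K -> ends_in K -> closed K.
Proof.
move=> dK endK y clKy.
suff fixed (s : seq 'I_n) :
    closure (K `&` [set x | forall j, j \in s -> x ord0 j = y ord0 j]) y.
  have [x [[Kx xy] _]] := fixed (enum 'I_n) setT filterT.
  by rewrite (_ : y = x)//; apply/rowP => j; rewrite xy// mem_enum.
elim: s => [|j s ih].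
  by rewrite (_ : mkset _ = setT) ?setIT//; apply/seteqP; split.
move=> U /nbhs_ballP[e /= e0 eU].
pose Ks := K `&` [set x : 'rV_n | forall j, j \in s -> x ord0 j = y ord0 j].
pose B := box (fun i => y ord0 i - e / 2) (fun i => y ord0 i + e / 2).
have e20 : 0 < e / 2 by rewrite divr_gt0.
have yB : nbhs y B.
  apply/nbhs_ballP; exists (e / 2) => //= x [_ yx] i /=.
  by have := yx ord0 i; rewrite /ball/= in_itv/= ltr_norml => /andP[? ?]; apply/andP; split; lra.
have BU : B `<=` U.
  move=> x xB; apply: eU; split=> // k i; rewrite (ord1 k).
  by have := xB i; rewrite /ball/= in_itv/= ltr_norml => /andP[? ?]; apply/andP; split; lra.
have dKB : definable M (Ks `&` B).
  by apply: definableI (definable_box _ _); exact: definableI (definable_fix _ _).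
have endKB : ends_in (Ks `&` B).
  apply: ends_inI; first exact: closed_box.
  by apply: ends_inI; first exact: closed_fix.
have /(compact_closed (@Rhausdorff R)) cl := compact_coord (j := j) dKB endKB.
have [|x [[Kx xs] Bx] xy] := cl (y ord0 j).
  move=> V yV.
  have yjV : nbhs y [set x : 'rV_n | V (x ord0 j)] by exact: coord_continuous.
  have [x [Ksx [Bx Vx]]] := ih _ (filterI yB yjV).
  by exists (x ord0 j); split=> //; exists x.
exists x; split; last exact: BU.
by split=> // k; rewrite inE => /predU1P[->|/xs].
Qed.

Lemma ends_in_compact n (K : set 'rV[R]_n) :
  definable M K -> ends_in K -> compact K.
Proof.
move=> dK endK; apply: (subclosed_compact (ends_in_closed dK endK)).
  by apply: rV_compact => j; exact: (compact_coord dK endK).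
by move=> x Kx j; exists x.
Qed.

End Affine.

(** * Definable spaces *)

Section Space.
Variables (R : realType) (M : expansion R) (X : definable_space M).

Definition definable_subset (E : set X) : Prop :=
  forall i, definable M (chart i @` (E `&` chart_dom i)).

Lemma chart_imageP i (E : set X) x : chart_dom i x ->
  (chart i @` (E `&` chart_dom i)) (chart i x) <-> E x.
Proof.
move=> dx; split=> [[y [Ey dy] e]|Ex]; last by exists x.
by rewrite -(chart_inj dy dx e).
Qed.

Lemma definable_subsetC (E : set X) : definable_subset E -> definable_subset (~` E).
Proof.
move=> dE i; rewrite (_ : image _ _ =
    chart i @` chart_dom i `&` ~` (chart i @` (E `&` chart_dom i))).
  by apply: definableI (chart_definable i) _; exact/definableC/dE.
apply/seteqP; split=> [_ [x [nEx dx] <-]|_ [[x dx <-]]].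
  by split; [exists x|move/(chart_imageP E dx)].
by move=> nEx; exists x => //; split=> // /(chart_imageP E dx).
Qed.

Lemma definable_subsetI (E E' : set X) :
  definable_subset E -> definable_subset E' -> definable_subset (E `&` E').
Proof. by move=> dE dE' i; rewrite chart_imageI; exact: definableI. Qed.

Lemma definable_subsetT : definable_subset setT.
Proof. by move=> i; rewrite setTI; exact: chart_definable. Qed.

Lemma definable_chart_dom i : definable_subset (chart_dom i).
Proof. by move=> j; rewrite setIC; exact: overlap_definable. Qed.

Definition transition_graph i j := [set row_mx (chart i x) (chart j x) |
  x in (chart_dom i `&` chart_dom j : set X)].

Arguments transition_graph : clear implicits.

Lemma definable_transition_graph i j : definable M (transition_graph i j).
Proof.
have [g gE [_ dg _ _]] := transition_homeo i j.
rewrite (_ : transition_graph i j = [set row_mx x (g x) | x in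
  chart i @` (chart_dom i `&` chart_dom j)])//.
apply/seteqP; split=> [_ [x [di dj] <-]|_ [_ [x [di dj] <-] <-]].
  by exists (chart i x); [exists x|rewrite gE].
by exists x => //; rewrite gE.
Qed.

Lemma definable_chart_preimage i (W : set 'rV[R]_(chart_dim i)) :
  definable M W -> definable_subset (chart_dom i `&` chart i @^-1` W).
Proof.
move=> dW j; rewrite (_ : image _ _ =
    [set y | exists w, transition_graph j i (row_mx y w) /\ W w]).
  apply: definable_ex_row; apply: definable_and.
    apply: (definable_preimage (definable_transition_graph j i)) => k.
    by apply: atomic_row_mx => l; coordinate.
  by apply: (definable_preimage dW) => k; coordinate.
apply/seteqP; split=> [_ [x [[di Wx] dj] <-]|y [w [[x [dj di] /eq_row_mx[<- <-]] Wx]]].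
  by exists (chart i x); split=> //; exists x.
by exists x.
Qed.

Definition cube n (y : 'rV[R]_n) (e : R) : set 'rV[R]_n :=
  [set x | forall i, y ord0 i - e < x ord0 i /\ x ord0 i < y ord0 i + e].

Lemma definable_cube n (y : 'rV[R]_n) e : definable M (cube y e).
Proof.
apply: definable_forall_ord => i; apply: definable_and; apply: definable_lt.
- exact: atomic_const.
- exact: atomic_coord.
- exact: atomic_coord.
- exact: atomic_const.
Qed.

Lemma open_cube n (y : 'rV[R]_n) e : open (cube y e).
Proof.
rewrite openE => x xy; rewrite /interior /cube.
apply: (@filter_forall _ _ _ (nbhs x)) => i.
have cx (U : set R) : nbhs (x ord0 i) U -> nbhs x [set z : 'rV_n | U (z ord0 i)].
  exact: coord_continuous.
have [/lt_nbhsr/cx xl /lt_nbhsl/cx xu] := xy i.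
exact: filterI xl xu.
Qed.

Lemma cube_nbhs n (y : 'rV[R]_n) (U : set 'rV[R]_n) : nbhs y U ->
  exists2 e, 0 < e & cube y e `<=` U.
Proof.
move=> /nbhs_ballP[e /= e0 eU]; exists e => // x xy; apply: eU; split=> // k i.
by rewrite (ord1 k) /ball/= ltr_norml; have [? ?] := xy i; apply/andP; split; lra.
Qed.

Lemma open_chart_preimage i (W : set 'rV[R]_(chart_dim i)) :
  open W -> open (chart_dom i `&` chart i @^-1` W : set X).
Proof.
move=> oW; apply/chart_homeo; first exact: subIsetl.
exists W => //; apply/seteqP; split=> [_ [x [dx Wx] <-]|_ [[x dx <-] Wx]].
  by split=> //; exists x.
by exists x.
Qed.

(** Preimages of cubes by a chart are a basis of definable open sets. *)
Lemma nbhs_definable (x : X) (U : set X) : nbhs x U -> exists i O,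
  [/\ open O, O x, definable_subset O, O `<=` chart_dom i & O `<=` U].
Proof.
rewrite nbhsE => -[V [oV Vx] VU]; have [i dx] := chart_cover x.
have [W oW eW] := oV i.
have /cube_nbhs[e e0 eW'] : nbhs (chart i x) W.
  apply: open_nbhs_nbhs; split=> //.
  have : (chart i @` (V `&` chart_dom i)) (chart i x) by apply/chart_imageP.
  by rewrite eW => -[].
exists i, (chart_dom i `&` chart i @^-1` cube (chart i x) e); split.
- by apply: open_chart_preimage; exact: open_cube.
- by split=> // k; split; [rewrite ltrBlDr ltrDl|rewrite ltrDl].
- by apply: definable_chart_preimage; exact: definable_cube.
- exact: subIsetl.
- move=> y [dy /eW' Wy]; apply: VU; apply/(chart_imageP V dy).
  by rewrite eW; split=> //; exists y.
Qed.

Lemma chart_continuous i (x : X) (W : set 'rV[R]_(chart_dim i)) : chart_dom i x ->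
  nbhs (chart i x) W -> nbhs x (chart_dom i `&` chart i @^-1` W).
Proof.
rewrite (@nbhsE _ (chart i x)) => dx [V [oV Vx] VW].
rewrite nbhsE; exists (chart_dom i `&` chart i @^-1` V).
  by split=> //; exact: open_chart_preimage.
by move=> y [dy Vy]; split=> //; exact: VW.
Qed.

Lemma chart_inv_continuous i (x : X) (U : set X) : chart_dom i x -> nbhs x U ->
  exists2 W, nbhs (chart i x) W &
    forall y, chart_dom i y -> W (chart i y) -> U y.
Proof.
rewrite nbhsE => dx [V [oV Vx] VU]; have [W oW eW] := oV i; exists W.
  apply: open_nbhs_nbhs; split=> //.
  have : (chart i @` (V `&` chart_dom i)) (chart i x) by apply/chart_imageP.
  by rewrite eW => -[].
move=> y dy Wy; apply: VU; apply/(chart_imageP V dy).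
by rewrite eW; split=> //; exists y.
Qed.

Lemma compact_chart_image i (E : set X) : E `<=` chart_dom i ->
  compact (chart i @` E) -> compact E.
Proof.
move=> Ei cE F FF FE.
have KF : (chart i @ F) (chart i @` E) by apply: (@filterS _ F) FE => x Ex; exists x.
have [_ [[x Ex <-] xF]] := cE (chart i @ F) _ KF.
exists x; split=> // B U FB /(chart_inv_continuous (Ei _ Ex))[W xW WU].
have BF : (chart i @ F) (chart i @` (B `&` E)).
  by apply: (@filterS _ F) (filterI FB FE) => y By; exists y.
have [_ [[y [By Ey] <-] Wy]] := xF _ _ BF xW.
by exists y; split=> //; exact: WU (Ei _ Ey) Wy.
Qed.

Section Curves.
Hypothesis hM : o_minimal M.

(** A cluster point of a curve at an end is its limit there: by o-minimality the
    curve eventually stays in, or eventually avoids, each definable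
    neighbourhood. *)
Lemma compact_definably_compact : compact [set: X] -> definably_compact X.
Proof.
move=> cX a b alpha [ab _ dalpha].
suff ends F : end_filter a b F -> exists x : X, alpha @ F --> x.
  by split; apply: ends; [left|right].
move=> endF; have FF := end_filter_proper endF.
have [x [_ xF]] := cX (alpha @ F) _ filterT.
exists x => U /nbhs_definable[i [ O [oO Ox dO Oi OU]]].
suff : \forall t \near F, O (alpha t) by apply: filterS => t; exact: OU.
pose graph := [set row_mx (const_mx t : 'rV_1) (chart i (alpha t)) | t in
  [set t | (a < t%:E < b)%E /\ chart_dom i (alpha t)]].
pose A := [set t : 'rV[R]_1 | exists w,
  graph (row_mx t w) /\ (chart i @` (O `&` chart_dom i)) w].
have AE t : A (const_mx t) <-> (a < t%:E < b)%E /\ O (alpha t).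
  split=> [[w [[s [abs ds] /eq_row_mx[st <-]]]]|[abt Ot]].
    have <- : s = t.
      by have := congr1 (fun z : 'rV_1 => z ord0 ord0) st; rewrite !mxE.
    by move=> /(chart_imageP O ds).
  have dt := Oi _ Ot; exists (chart i (alpha t)); split; first by exists t.
  by apply/chart_imageP.
have dA : definable M A.
  apply: definable_ex_row; apply: definable_and.
    by apply: (definable_preimage (dalpha i)) => k; apply: atomic_row_mx => l; coordinate.
  by apply: (definable_preimage (dO i)) => k; coordinate.
have [FA|FnA] := o_minimal_eventually hM endF dA.
  by apply: filterS FA => t /AE[].
have xO : nbhs x O by exact: open_nbhs_nbhs.
have aF : (alpha @ F) [set y | ~ O y].
  apply: filterS2 FnA (end_filter_near ab endF) => t nA abt Ot.
  by apply: nA; apply/AE.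
by have [y [nOy Oy]] := xF _ _ aF xO.
Qed.

Hypotheses (hS : definable_skolem M) (cX : definably_compact X).

(** A definable map [f] into the image of [E] is continuous near the ends of its
    interval, so it comes from a curve in [X] there; this curve has a limit in [X],
    which the closed set [E] contains. *)
Lemma ends_in_chart_image i (E : set X) : closed E -> E `<=` chart_dom i ->
  ends_in M (chart i @` E).
Proof.
move=> clE Ei a b F f ab endF df fE; have FF := end_filter_proper endF.
have [t0 /fE[x0 Ex0 _]] := between ab.
have /choice[alpha alphaE] : forall t, exists x : X, (a < t%:E < b)%E ->
    E x /\ chart i x = f t.
  move=> t; have [/fE[x Ex xt]|nab] := pselect (a < t%:E < b)%E; first by exists x.
  by exists x0.
have [a' [b' [ab' endF' cont]]] :=
  end_filter_itv ab endF (eventually_continuous hM ab endF df).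
have subab t : (a' < t%:E < b')%E -> (a < t%:E < b)%E by case/cont.
have curve : definable_curve a' b' alpha.
  split=> // [|j].
    apply: continuous_in_subspaceT => t; rewrite inE/= => abt.
    have [abt1 ft] := cont _ abt; have [Et et] := alphaE _ abt1.
    move=> U /(chart_inv_continuous (Ei _ Et))[W]; rewrite et => tW WU.
    have fW : \forall s \near t, W (f s) by exact: ft.
    apply: filterS2 fW (near_itv abt1) => s Ws /alphaE[Es es].
    by apply: WU; [exact: Ei|rewrite es].
  pose fgraph := [set row_mx (const_mx t : 'rV_1) (f t) | t in
    [set t | (a < t%:E < b)%E]].
  rewrite (_ : image _ _ = [set z : 'rV[R]_(1 + chart_dim j) | exists y,
      fgraph (row_mx (lsubmx z) y) /\ (transition_graph i j (row_mx y (rsubmx z)) /\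
      (a' < (lsubmx z ord0 ord0)%:E < b')%E)]).
    apply: definable_ex_row; apply: definable_and; last apply: definable_and.
    - by apply: (definable_preimage df) => k; apply: atomic_row_mx => l; coordinate.
    - apply: (definable_preimage (definable_transition_graph i j)) => k.
      by apply: atomic_row_mx => l; coordinate.
    - by apply: definable_itv; coordinate.
  apply/seteqP; split=> [_ [t [abt dj] <-]|z /= [y []]].
    have abt1 := subab _ abt; have [Et et] := alphaE _ abt1.
    exists (f t); rewrite row_mxKl row_mxKr mxE; split; first by exists t.
    by split=> //; exists (alpha t); [split=> //; exact: Ei|rewrite et].
  move=> [t abt /eq_row_mx[tz fty]] [[x [di dj] /eq_row_mx[xy xz]] abz].
  have zt : lsubmx z ord0 ord0 = t by rewrite -tz mxE.
  have [Et et] := alphaE _ abt.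
  have xt : alpha t = x by apply: (chart_inj (Ei _ Et) di); rewrite et xy.
  by exists t; [rewrite xt -zt|rewrite xt xz tz hsubmxK].
have [x ax] : exists x : X, alpha @ F --> x.
  by have [[x xa] [y yb]] := cX curve; case: endF' => ->; [exists x|exists y].
have Ex : E x.
  apply: (closed_cvg _ clE _ _ ax).
  by apply: filterS (end_filter_near ab endF) => t /alphaE[].
exists (chart i x); first by exists x.
move=> W /(chart_continuous (Ei _ Ex)) xW.
have aW : \forall t \near F, (chart_dom i `&` chart i @^-1` W) (alpha t) by exact: ax.
suff : \forall t \near F, W (f t) by [].
apply: filterS2 aW (end_filter_near ab endF) => t [_ Wt] /alphaE[_ et].
by rewrite -et.
Qed.

Lemma compact_closed_in_chart i (E : set X) :
  closed E -> definable_subset E -> E `<=` chart_dom i -> compact E.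
Proof.
move=> clE dE Ei; apply: (compact_chart_image Ei).
apply: (ends_in_compact hM hS); last exact: ends_in_chart_image.
by have := dE i; rewrite (setIidl Ei).
Qed.

(** Finitely many definable open sets cover [B], and what they leave of [Z] is
    closed, definable and inside one chart, hence compact. In terms of a filter [F]
    on [Z] without cluster point, the open definable sets whose complement is in
    [F] form a directed cover of [Z], and one of them contains [B `&` Z]. *)
Lemma compact_absorb (Z B : set X) i : closed Z -> definable_subset Z ->
  compact B -> Z `\` chart_dom i `<=` B -> compact Z.
Proof.
move=> clZ dZ cB ZB F FF FZ; apply: contrapT => noc.
pose null (O : set X) := [/\ open O, definable_subset O & F (~` O)].
have null0 : null set0.
  split; [exact: open0| |by rewrite setC0; exact: filterT].
  by rewrite -setCT; exact/definable_subsetC/definable_subsetT.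
have nullU O O' : null O -> null O' -> null (O `|` O').
  move=> [oO dO FO] [oO' dO' FO']; split; first exact: openU.
    rewrite -(setCK (O `|` O')) setCU; apply: definable_subsetC.
    by apply: definable_subsetI; exact: definable_subsetC.
  by rewrite setCU; exact: filterI.
have null_point x : Z x -> exists2 O, null O & O x.
  move=> Zx; have /existsNP[A /existsNP[U]] : ~ cluster F x.
    by move=> xF; apply: noc; exists x.
  move=> /not_implyP[FA /not_implyP[xU]]; move=> AU.
  have [j [ O [oO Ox dO _ OU]]] := nbhs_definable xU.
  exists O => //; split=> //; apply: filterS FA => y Ay Oy; apply: AU.
  by exists y; split=> //; exact: OU.
have [ O [oO dO FO] BO] : exists2 O, null O & B `&` Z `<=` O.
  apply: contrapT => nO.
  pose G := filter_from null (fun O => B `&` Z `\` O).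
  have GG : ProperFilter G.
    apply: filter_from_proper; last first.
      move=> O nullO; apply/set0P/negP => /eqP BO; apply: nO; exists O => //.
      by rewrite -setD_eq0.
    apply: filter_from_filter; first by exists set0.
    move=> O O' nO1 nO2; exists (O `|` O'); first exact: nullU.
    by move=> x [BZx nOO]; split; split=> // Ox; apply: nOO; [left|right].
  have [|x [Bx xG]] := cB G GG.
    by exists set0 => // x [[]].
  have Zx : Z x.
    apply: clZ => U xU.
    have [|y [Zy Uy]] := xG Z U _ xU; last by exists y.
    by exists set0 => // y [[]].
  have [ O nullO Ox] := null_point x Zx; have [oO _ _] := nullO.
  have [|y [[_ nOy] Oy]] := xG (B `&` Z `\` O) O _ (open_nbhs_nbhs (conj oO Ox)).
    by exists O.
  by [].
have cE : compact (Z `&` ~` O).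
  apply: (@compact_closed_in_chart i).
  - by apply: closedI => //; exact: open_closedC.
  - by apply: definable_subsetI => //; exact: definable_subsetC.
  - move=> x [Zx nOx]; apply: contrapT => ndx; apply: nOx; apply: BO.
    by split=> //; apply: ZB.
by have [|x [[Zx _] xF]] := cE F FF; [exact: filterI|apply: noc; exists x].
Qed.

(** The charts are removed from [X] one after the other, which leaves closed sets
    [Z k] decreasing from [X] to the empty set, with [Z k] and [Z k.+1] differing by
    a subset of one chart. Compactness climbs back from the empty set to [X]. *)
Lemma definably_compact_compact : compact [set: X].
Proof.
pose Z k : set X := [set x | forall i : 'I_(nb_charts X), (i < k)%N -> ~ chart_dom i x].
have ZS k (kn : (k < nb_charts X)%N) : Z k.+1 = Z k `&` ~` chart_dom (Ordinal kn).
  apply/seteqP; split=> x.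
    by move=> Zx; split=> [i ik|]; apply: Zx => //; exact: ltnW.
  move=> [Zx nd] i; rewrite ltnS leq_eqVlt => /orP[/eqP ik|]; last exact: Zx.
  by have -> : i = Ordinal kn by exact: val_inj.
have Z0 : Z 0%N = setT by apply/seteqP; split=> x.
have regZ k : (k <= nb_charts X)%N -> closed (Z k) /\ definable_subset (Z k).
  elim: k => [_|k ih kn].
    by rewrite Z0; split; [exact: closedT|exact: definable_subsetT].
  have [clZ dZ] := ih (ltnW kn); rewrite ZS; split.
    by apply: closedI => //; apply: open_closedC; exact: chart_dom_open.
  by apply: definable_subsetI => //; apply/definable_subsetC/definable_chart_dom.
suff cZ d k : (d + k = nb_charts X)%N -> compact (Z k).
  by rewrite -Z0; apply: (cZ (nb_charts X)); rewrite addn0.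
elim: d k => [k|d ih k dk].
  rewrite add0n => ->; rewrite (_ : Z _ = set0); first exact: compact0.
  apply/seteqP; split=> x // Zx; have [i dx] := chart_cover x.
  by apply: (Zx i).
have kn : (k < nb_charts X)%N by rewrite -dk addSn ltnS leq_addl.
have [clZ dZ] := regZ _ (ltnW kn).
apply: (compact_absorb (i := Ordinal kn) clZ dZ (ih k.+1 _)); last by rewrite ZS.
by rewrite addnS -addSn.
Qed.

End Curves.
End Space.

Theorem proposition4p10 (R : realType) (M : expansion R)
    (hM : o_minimal M) (hS : definable_skolem M)
    (X : definable_space M) (hX : hausdorff_space X) :
  definably_compact X <-> compact [set: X].
Proof.
split; first exact: definably_compact_compact.
exact: compact_definably_compact.
Qed.
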